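(* Fix an integer $t\ge 2$. There exists $k_0=k_0(t)$ such that the following holds for all integers $k\ge k_0$ and $n\ge 16t^2k^2$. If $\mathcal F\subset\binom{[n]}{k}$ and $|\mathcal F|\ge 2t^2k\binom{n-2}{k-2}$, then either $d(\mathcal F)\ge\big(1-\frac1t\big)|\mathcal F|$, or there exists a set $S\subset[n]$ with $|S|\le t$ such that $\mathcal F(\bar S)=\emptyset$ and $|\mathcal F(x)|\ge k^{-1/2}|\mathcal F|$ for every $x\in S$. In particular, if $d(\mathcal F)<\big(1-\frac1t\big)|\mathcal F|$ then $\tau(\mathcal F)\le t$.
   Context: $\binom{[n]}{k}$ denotes the family of all $k$-element subsets of $[n]$. For $\mathcal F\subset\binom{[n]}{k}$, $d(\mathcal F)=\max_{F\in\mathcal F}|\{G\in\mathcal F: G\cap F=\emptyset\}|$ (the maximum degree of the induced subgraph of the Kneser graph on $\mathcal F$). For $P\subset[n]$, $\mathcal F(\bar P)=\{F\in\mathcal F: F\cap P=\emptyset\}$, and $\mathcal F(x)=\{F\setminus\{x\}: x\in F\in\mathcal F\}$. The covering number $\tau(\mathcal F)$ is the minimum size of a set $S\subset[n]$ with $\mathcal F(\bar S)=\emptyset$. *)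

(* Defs.v *)
(* The ground set [n] is represented by 'I_n. *)
From mathcomp Require Import all_boot all_order all_algebra.

Set Implicit Arguments.
Unset Strict Implicit.
Unset Printing Implicit Defensive.

Section Families.

Variable n : nat.
Implicit Types (F : {set {set 'I_n}}) (A B S P : {set 'I_n}).

Definition ksubsets (k : nat) : {set {set 'I_n}} :=
  [set A : {set 'I_n} | #|A| == k].

(* The maximum over an empty family is 0. *)
Definition max_disjoint_degree F : nat :=
  \max_(A in F) #|[set B in F | B :&: A == set0]|.

Definition avoiding F P : {set {set 'I_n}} := [set A in F | A :&: P == set0].

Definition link F (x : 'I_n) : {set {set 'I_n}} :=
  [set A :\ x | A in F & x \in A].

(* When set0 \in F no S satisfies the condition, and the value is then the
   irrelevant default #|setT| = n; otherwise setT satisfies it and this is the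
   genuine minimum. *)
Definition covering_number F : nat :=
  #|[arg min_(S < [set: 'I_n] | avoiding F S == set0) #|S|]|.

End Families.

(* Main.v *)
Require Import Defs.
From mathcomp Require Import all_boot all_order all_algebra.
From mathcomp Require Import zify ring lra.

Import Order.TTheory GRing.Theory Num.Theory.

(* Write N = |F|, F(x) for the members of F through x, and suppose that every
   member of F meets more than N/t members of F. Call x heavy when
   |F(x)| >= N / sqrt k; the set S of the theorem is the set of heavy points.

   If G is a subfamily of F with |G| >= N/k, a maximal set X with
   |G| <= r^|X| |G(X)|, r = 4 t^2 k, makes G(X) spread, so some A in G(X) has
   only N/(4t^2) members of F meeting A \ X. As n >= 4rk, |X| = O(log k), so
   the light points of X lie in o(N) members of F; hence the heavy points of A
   lie in at least about (1/t - 1/(4t^2)) N members of F. When G consists of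
   the members meeting S in {h} alone, this bounds |F(h)| from below, and pair
   degrees being small gives |S| <= t. When G consists of the members avoiding
   S, it is a contradiction, so fewer than N/k members avoid S. Finally a
   member avoiding S would meet at most t k C(n-2,k-2) + N/k < N/t members. *)

(** * Stars, members meeting a set, and spread subfamilies *)

Section Stars.

Set Implicit Arguments.
Unset Strict Implicit.
Unset Printing Implicit Defensive.

Variable T : finType.
Implicit Types (F G : {set {set T}}) (A B X H : {set T}) (x y h : T).

Definition star F X : {set {set T}} := [set A in F | X \subset A].

Definition meeting F A : {set {set T}} := [set B in F | B :&: A != set0].

Definition star_only F H h : {set {set T}} :=
  [set A in F | A :&: H == [set h]].

Lemma card_star k F X :
  (forall A, A \in F -> #|A| = k) ->
  #|star F X| <= 'C(#|T| - #|X|, k - #|X|).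
Proof.
move=> Fk; have -> : #|T| - #|X| = #|~: X| by have := cardsC X; lia.
rewrite -cards_draws.
have inj : {in star F X &, injective (fun A => A :\: X)}.
  move=> A B; rewrite !inE => /andP[_ XA] /andP[_ XB] eqAB.
  by rewrite -(setID A X) -(setID B X) eqAB (setIidPr XA) (setIidPr XB).
rewrite -(card_in_imset inj); apply/subset_leq_card/subsetP => _ /imsetP[A + ->].
rewrite !inE => /andP[/Fk Ak XA].
by rewrite setDE subsetIr -setDE cardsD (setIidPr XA) Ak eqxx.
Qed.

Lemma card_meeting_le F A : #|meeting F A| <= \sum_(x in A) #|star F [set x]|.
Proof.
have sub : meeting F A \subset \bigcup_(x in A) star F [set x].
  apply/subsetP => B; rewrite inE => /andP[BF /set0Pn[x]].
  rewrite inE => /andP[xB xA]; apply/bigcupP; exists x => //.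
  by rewrite inE BF sub1set.
apply: leq_trans (subset_leq_card sub) _.
elim/big_rec2: _ => [|x m U _ le_m]; first by rewrite cards0.
by rewrite cardsU; lia.
Qed.

Lemma meetingU F A B : #|meeting F (A :|: B)| <= #|meeting F A| + #|meeting F B|.
Proof.
rewrite -cardsUI; apply: leq_trans (leq_addr _ _); apply/subset_leq_card/subsetP => C.
by rewrite !inE setIUr setU_eq0 negb_and andb_orr.
Qed.

Lemma star_star F X x : star (star F X) [set x] = star F (x |: X).
Proof.
by apply/setP => A; rewrite !inE subUset -andbA [(_ \subset _) && _]andbC.
Qed.

(** A member through [h] outside [star_only F H h] contains a second point of [H], so it lies in one
    of fewer than [#|H|] pair stars. *)
Lemma card_star_only F H h d :
  (forall h', h' != h -> #|star F [set h; h']| <= d) ->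
  h \in H ->
  #|star F [set h]| <= #|star_only F H h| + #|H| * d.
Proof.
move=> dle hH.
have sub : star F [set h] \subset star_only F H h :|: meeting (star F [set h]) (H :\ h).
  apply/subsetP => A; rewrite !inE sub1set => /andP[AF hA]; rewrite AF hA /=.
  case: eqVneq => //= neq; apply: contra neq => /eqP A0.
  apply/eqP/setP => y; rewrite !inE.
  move/setP/(_ y): A0; rewrite !inE.
  by case: eqVneq => [->|_] /=; rewrite ?hA ?hH.
apply: leq_trans (subset_leq_card sub) _; rewrite cardsU.
apply: leq_trans (leq_subr _ _) _; rewrite leq_add2l.
apply: leq_trans (card_meeting_le _ _) _.
have -> : #|H| * d = \sum_(y in H) d by rewrite sum_nat_const.
rewrite [leqRHS](bigD1 h) //= addnC; apply: leq_trans (leq_addr _ _).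
rewrite (eq_bigl (fun y => (y \in H) && (y != h))); last first.
  by move=> y; rewrite !inE andbC.
by apply: leq_sum => y /andP[_ yh]; rewrite star_star setUC dle.
Qed.

(** The trace [A :&: H] determines [h], so these subfamilies are disjoint. *)
Lemma sum_card_star_only F H : \sum_(h in H) #|star_only F H h| <= #|F|.
Proof.
have cardE h : #|star_only F H h| = \sum_(A in F) (A :&: H == [set h]).
  by rewrite -sum1_card -big_mkcondr /=; apply: eq_bigl => A; rewrite inE.
rewrite (eq_bigr _ (fun h _ => cardE h)) exchange_big /= -[leqRHS]sum1_card.
apply: leq_sum => A _.
case: (boolP [exists h in H, A :&: H == [set h]]) => [|none].
  case/existsP => h /andP[hH /eqP AH].
  rewrite (bigD1 h) //= AH eqxx big1 // => h' /andP[_ ne].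
  by case: eqP => // /set1_inj eqh; rewrite eqh eqxx in ne.
rewrite big1 // => h hH; case: eqP => // AH.
by case/negP: none; apply/existsP; exists h; rewrite hH AH eqxx.
Qed.

(** A Bonferroni-type bound: passing from a star to its members with a single point in [H] costs at
    most [#|H| * d]. *)
Lemma sum_card_star F H d :
  (forall x y, y != x -> #|star F [set x; y]| <= d) ->
  \sum_(h in H) #|star F [set h]| <= #|F| + #|H| * (#|H| * d).
Proof.
move=> dle; apply: leq_trans (leq_add (sum_card_star_only F H) (leqnn _)).
rewrite -sum_nat_const -big_split /=; apply: leq_sum => h hH.
by apply: card_star_only => // h'; apply: dle.
Qed.

(** Take [X] of maximum size with the first bound, which [set0] satisfies. The bound fails for
    [y |: X], and comparing the two gives the factor [r]. *)
Lemma spread_star r G : G != set0 -> 0 < r ->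
  exists X, [/\ #|G| <= r ^ #|X| * #|star G X|
              & forall y, y \notin X -> r * #|star G (y |: X)| <= #|star G X|].
Proof.
move=> G0 r0; pose P X := #|G| <= r ^ #|X| * #|star G X|.
have P0 : P set0.
  rewrite /P cards0 mul1n; apply/subset_leq_card/subsetP => A AG.
  by rewrite inE AG sub0set.
case: (arg_maxnP (fun X => #|X|) P0) => X PX maxX; exists X; split=> // y yX.
have : ~~ P (y |: X).
  by apply: contraL isT => /maxX /=; rewrite cardsU1 yX add1n ltnn.
rewrite /P -ltnNge cardsU1 yX add1n expnS => lt1.
have := leq_trans lt1 PX.
by rewrite [r * _]mulnC -mulnA ltn_pmul2l ?expn_gt0 ?r0 //; apply: ltnW.
Qed.

(** Averaging over [A] in [star G X]: a given [B] has at most [k] points outside [X], and each lies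
    in at most a fraction [1/r] of these [A]. *)
Lemma spread_star_meeting k r F G X :
  (forall B, B \in F -> #|B| <= k) ->
  (forall y, y \notin X -> r * #|star G (y |: X)| <= #|star G X|) ->
  star G X != set0 ->
  exists2 A, A \in star G X & r * #|meeting F (A :\: X)| <= k * #|F|.
Proof.
move=> Fk spread GX0; apply/exists_inP; apply: contraT.
rewrite negb_exists_in => /forall_inP none.
have lt1 : #|star G X| * (k * #|F|) < \sum_(A in star G X) r * #|meeting F (A :\: X)|.
  rewrite -sum_nat_const.
  have le1 A : A \in star G X -> (k * #|F|).+1 <= r * #|meeting F (A :\: X)|.
    by move/none; rewrite -ltnNge.
  apply: leq_trans (leq_sum _ le1).
  rewrite !sum_nat_const ltn_pmul2l // lt0n cards_eq0 //.
suff : \sum_(A in star G X) r * #|meeting F (A :\: X)| <= #|star G X| * (k * #|F|).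
  by rewrite leqNgt lt1.
have le2 A : r * #|meeting F (A :\: X)| <= \sum_(B in F) \sum_(y in B :\: X) r * (y \in A).
  rewrite -sum1_card big_distrr /= (eq_bigl (fun B => (B \in F) && (B :&: (A :\: X) != set0))).
    rewrite big_mkcondr /=; apply: leq_sum => B BF.
    case: ifP => // /set0Pn[y]; rewrite !inE => /and3P[yB yX yA].
    by rewrite (bigD1 y) /= ?inE ?yX // yA leq_addr.
  by move=> B; rewrite inE.
apply: leq_trans (leq_sum _ (fun A _ => le2 A)) _.
rewrite exchange_big /= [k * _]mulnC mulnCA -sum_nat_const.
apply: leq_sum => B BF; rewrite exchange_big /=.
have le3 y : y \in B :\: X -> \sum_(A in star G X) r * (y \in A) <= #|star G X|.
  rewrite inE => /andP[yX _]; apply: leq_trans (spread y yX).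
  rewrite -big_distrr /= leq_mul2l; apply/orP; right.
  rewrite -sum1_card -big_mkcondr /= -star_star; apply: eq_leq; apply: eq_bigl => A.
  by rewrite !inE sub1set.
apply: leq_trans (leq_sum _ le3) _; rewrite sum_nat_const mulnC leq_mul2l.
by rewrite (leq_trans (subset_leq_card (subsetDl _ _)) (Fk _ BF)) orbT.
Qed.

End Stars.

(** * Decay of binomial coefficients and numerical bounds for large [k] *)

(** The ratio of the two binomials is [(n - j) / (k - j)], which is at least [n / k]. *)
Lemma bin_pred_diag_le c n k j : c * k <= n -> j < k -> 0 < c ->
  c * 'C(n - j.+1, k - j.+1) <= 'C(n - j, k - j).
Proof.
move=> ckn jk c0; have := mul_bin_diag (n - j) (k - j.+1).
have -> : (n - j).-1 = n - j.+1 by lia.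
have -> : (k - j.+1).+1 = k - j by lia.
move=> eqb; have kj : 0 < k - j by lia.
rewrite -(leq_pmul2l kj) -eqb mulnA leq_mul2r; apply/orP; right.
nia.
Qed.

Lemma bin_sub_decay c n k i l : c * k <= n -> 0 < c -> i <= l <= k ->
  c ^ (l - i) * 'C(n - l, k - l) <= 'C(n - i, k - i).
Proof.
move=> ckn c0; elim: l => [|l IHl] /andP[il lk].
  have -> : i = 0 by lia.
  by rewrite subnn mul1n.
case: (ltngtP i l.+1) il => // [il _|-> _]; last by rewrite subnn mul1n.
rewrite subSn // expnSr -mulnA; apply: leq_trans (IHl _); last by lia.
by rewrite leq_mul2l bin_pred_diag_le ?orbT.
Qed.

(** With [q = l %/ 5], [l <= 5 * (q + 1) <= 5 * 2 ^ q]; raise to the fifth power and use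
    [5 * q <= l]. *)
Lemma exp5_le l : l ^ 5 <= 5 ^ 5 * 2 ^ l.
Proof.
have lq : l <= 5 * 2 ^ (l %/ 5) by have := ltn_expl (l %/ 5) (isT : 1 < 2); lia.
apply: leq_trans (_ : (5 * 2 ^ (l %/ 5)) ^ 5 <= _); first by rewrite leq_exp2r.
by rewrite expnMn leq_mul2l -expnM leq_exp2l // leq_divM orbT.
Qed.

Lemma expn4_le_bound c l : 4 ^ l <= c * l ^ 4 -> l <= 5 ^ 5 * c.
Proof.
case: l => // l le4; rewrite -(@leq_pmul2r (l.+1 ^ 4)) ?expn_gt0 //.
rewrite -expnS; apply: leq_trans (exp5_le _) _; rewrite -mulnA leq_mul2l.
by rewrite (leq_trans _ le4) ?orbT // leq_exp2r.
Qed.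

(** The least such [s] is an integer substitute for the square root of [k]. *)
Lemma square_between k : 9 <= k -> exists2 s, k <= s ^ 2 & s ^ 2 < 2 * k.
Proof.
move=> k9; have ex : exists s, k <= s ^ 2 by exists k; nia.
case: (ex_minnP ex) => s ks mins; exists s => //.
have : s.-1 ^ 2 < k by rewrite ltnNge; apply/negP => /mins; nia.
case: s ks {mins} => [|s] ks /= ; nia.
Qed.

(** The premise makes [l] logarithmic in [k]. If the conclusion failed, [k < 64 * t ^ 4 * l ^ 2]
    would turn it into [4 ^ l <= c * l ^ 4], bounding [l] and hence [k]. *)
Lemma pow4_le_square_log t : exists k0, forall k l,
  k0 <= k -> 4 ^ l <= 128 * t ^ 2 * k ^ 2 -> 64 * t ^ 4 * l ^ 2 <= k.
Proof.
pose c := 128 * t ^ 2 * (64 * t ^ 4) ^ 2.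
exists (64 * t ^ 4 * (5 ^ 5 * c) ^ 2) => k l k0k le4; rewrite leqNgt.
apply/negP => ltk.
have lel : l <= 5 ^ 5 * c.
  apply: expn4_le_bound; apply: leq_trans le4 _.
  have -> : c * l ^ 4 = 128 * t ^ 2 * (64 * t ^ 4 * l ^ 2) ^ 2 by rewrite /c; ring.
  by rewrite leq_mul2l leq_exp2r // ltnW // orbT.
have := leq_ltn_trans k0k ltk; rewrite ltnNge => /negP; apply.
by rewrite leq_mul2l leq_exp2r // lel orbT.
Qed.

(** * Heavy points: their degrees, their number, and the covering property *)

Section Heavy.

Set Implicit Arguments.
Unset Strict Implicit.
Unset Printing Implicit Defensive.

Variables (T : finType) (t k : nat) (F : {set {set T}}).
Implicit Types (G : {set {set T}}) (A B X : {set T}) (x y h : T).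

Let d := 'C(#|T| - 2, k - 2).

Hypotheses (t2 : 2 <= t) (k9 : 9 <= k) (kt2 : 4 * t.+1 ^ 2 <= k).
Hypothesis klog : forall l, 4 ^ l <= 128 * t ^ 2 * k ^ 2 -> 64 * t ^ 4 * l ^ 2 <= k.
Hypothesis T_large : 16 * t ^ 2 * k ^ 2 <= #|T|.
Hypothesis F_unif : forall A, A \in F -> #|A| = k.
Hypothesis F_large : 2 * t ^ 2 * k * d <= #|F|.
Hypothesis F_meeting : forall A, A \in F -> #|F| < t * #|meeting F A|.

(* |F(x)| >= k^(-1/2) |F|, squared to stay within nat *)
Definition heavy : {set T} := [set x | #|F| ^ 2 <= k * #|star F [set x]| ^ 2].

Let d_gt0 : 0 < d.
Proof. by rewrite bin_gt0; nia. Qed.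

Let F_gt0 : 0 < #|F|.
Proof. by apply: leq_trans F_large; rewrite !muln_gt0 d_gt0; nia. Qed.

Let pair_le x y : y != x -> #|star F [set x; y]| <= d.
Proof.
by move=> yx; have := card_star [set x; y] F_unif; rewrite cards2 eq_sym yx.
Qed.

Let r := 4 * t ^ 2 * k.

Lemma spread_center_small G X :
  G \subset F -> #|F| <= k * #|G| -> #|G| <= r ^ #|X| * #|star G X| ->
  64 * t ^ 4 * #|X| ^ 2 <= k.
Proof.
move=> GF FG GX; apply: klog.
have GX0 : 0 < #|star G X| by rewrite lt0n; apply/eqP => e0; move: GX; rewrite e0; nia.
have Xk : #|X| <= k.
  case/card_gt0P: GX0 => A; rewrite inE => /andP[/(subsetP GF)/F_unif <-].
  exact: subset_leq_card.
have G_unif A : A \in G -> #|A| = k by move/(subsetP GF)/F_unif.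
have leG := card_star X G_unif.
have r0 : 0 < r by rewrite /r; nia.
have dG : 2 * t ^ 2 * d <= #|G| by nia.
have [X2|X2] := leqP 2 #|X|; last first.
  apply: leq_trans (_ : 4 ^ 1 <= _); first by rewrite leq_exp2l.
  by nia.
(* Each point of [X] beyond two shrinks the binomial by [4 * r], since [4 * r * k] is the lower
   bound on [#|T|], but gains only [r] in [GX]. The surplus [4 ^ (l - 2)] bounds [l]. *)
have decay : (4 * r) ^ (#|X| - 2) * 'C(#|T| - #|X|, k - #|X|) <= d.
  apply: bin_sub_decay; [rewrite /r; nia | nia | by rewrite X2 Xk].
move: leG GX decay.
move: #|X| X2 {Xk GX0} => l l2; set b := 'C(_, k - l) => leG GX decay.
have step1 : 2 * t ^ 2 * d * 4 ^ (l - 2) <= r ^ 2 * d.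
  apply: leq_trans (_ : r ^ l * b * 4 ^ (l - 2) <= _).
    by rewrite leq_mul2r (leq_trans dG (leq_trans GX _)) ?orbT // leq_mul2l leG orbT.
  apply: leq_trans (_ : r ^ 2 * ((4 * r) ^ (l - 2) * b) <= _).
    rewrite -{1}(subnKC l2) expnD expnMn; apply: eq_leq; ring.
  by rewrite leq_mul2l decay orbT.
have -> : 4 ^ l = 16 * 4 ^ (l - 2) by rewrite -{1}(subnKC l2) expnD.
have step2 : 2 * t ^ 2 * 4 ^ (l - 2) <= r ^ 2.
  by rewrite -(leq_pmul2r d_gt0); apply: leq_trans step1; rewrite -!mulnA [d * _]mulnC.
have t0 : 0 < 2 * t ^ 2 by nia.
rewrite -(leq_pmul2l t0); apply: leq_trans (_ : 16 * r ^ 2 <= _); first by lia.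
by rewrite /r; apply: eq_leq; ring.
Qed.

(** Of the more than [#|F| / t] members meeting [A], those meeting [A :\: X] are at most
    [2 / (8 * t ^ 2)] of [F] and those through light points of [X] at most [1 / (8 * t ^ 2)]; hence
    the 3. *)
Lemma heavy_weight G : G \subset F -> #|F| <= k * #|G| ->
  exists2 A, A \in G
    & 8 * t * #|F| < 3 * #|F| + 8 * t ^ 2 * \sum_(x in A :&: heavy) #|star F [set x]|.
Proof.
move=> GF FG.
have G0 : G != set0 by rewrite -card_gt0; nia.
have r0 : 0 < r by rewrite /r; nia.
have [X [GX spread]] := spread_star G0 r0.
have smallX := spread_center_small GF FG GX.
have GX0 : star G X != set0.
  rewrite -cards_eq0; apply/eqP => e0; move: GX G0; rewrite e0 muln0 leqn0.
  by rewrite cards_eq0 => ->.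
have Fk B : B \in F -> #|B| <= k by move/F_unif ->.
have [A] := spread_star_meeting Fk spread GX0.
rewrite inE => /andP[AG XA] lightA; exists A => //.
have AF := subsetP GF A AG.
have cover : #|meeting F A| <= #|meeting F (A :\: X)|
   + (\sum_(x in X :\: heavy) #|star F [set x]| + \sum_(x in A :&: heavy) #|star F [set x]|).
  have eqA : A = (A :\: X) :|: ((X :\: heavy) :|: (X :&: heavy)).
    by rewrite [(X :\: _) :|: _]setUC setID setUC -{1}(setIidPr XA) setID.
  rewrite {1}eqA.
  apply: leq_trans (meetingU _ _ _) _; rewrite leq_add2l.
  apply: leq_trans (meetingU _ _ _) _; apply: leq_add; first exact: card_meeting_le.
  apply: leq_trans (card_meeting_le _ _) _.
  rewrite [leqRHS](big_setID X) /=; apply: leq_trans (leq_addr _ _); apply: eq_leq.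
  apply: eq_bigl => x; rewrite !inE; case: (boolP (x \in X)) => xX; rewrite ?andbF //=.
  by rewrite (subsetP XA) ?andbT.
have light_sum : 8 * t ^ 2 * \sum_(x in X :\: heavy) #|star F [set x]| <= #|F|.
  have [X0|Xgt0] := posnP #|X|.
    by move/cards0_eq: X0 => ->; rewrite set0D big_set0 muln0.
  rewrite -(leq_pmul2l Xgt0) mulnA big_distrr /=.
  apply: leq_trans (_ : \sum_(x in X :\: heavy) #|F| <= _); last first.
    by rewrite sum_nat_const leq_mul2r subset_leq_card ?orbT // subsetDl.
  (* Lightness is a bound on squares, and [(8 * t ^ 2 * #|X|) ^ 2] is exactly the quantity that
     [smallX] bounds by [k]. *)
  apply: leq_sum => x; rewrite !inE -ltnNge => /andP[lightx _].
  rewrite -leq_sqr; apply: leq_trans (ltnW lightx).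
  rewrite expnMn leq_mul2r; apply/orP; right; apply: leq_trans smallX.
  by apply: eq_leq; ring.
have spread_part : 4 * t ^ 2 * #|meeting F (A :\: X)| <= #|F|.
  have k0 : 0 < k by lia.
  by rewrite -(leq_pmul2l k0); apply: leq_trans lightA; rewrite /r; apply: eq_leq; ring.
have := F_meeting AF.
move: cover light_sum spread_part.
set a := #|meeting F A|; set b := #|meeting F _|; set c1 := \sum_(x in X :\: _) _.
set c2 := \sum_(x in _) _ => cover light_sum spread_part ltN.
have : 8 * t * #|F| < 8 * t ^ 2 * a.
  by rewrite -[8 * t ^ 2]/(8 * (t * t)) (mulnA 8) -[8 * t * t * a]mulnA ltn_pmul2l //; lia.
have := leq_mul (leqnn (8 * t ^ 2)) cover.
lia.
Qed.

Let pair_degrees_small s : s ^ 2 < 2 * k -> 4 * s ^ 2 * d < #|F|.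
Proof.
move=> s2; apply: leq_trans F_large; rewrite ltn_pmul2r //.
by apply: leq_trans (_ : 8 * k <= _); nia.
Qed.

(** A crude first bound: [2 * s] heavy points would have degree sum at least [2 * #|F|], while their
    overlaps cost less than [#|F|]. *)
Lemma card_heavy_lt s : k <= s ^ 2 -> s ^ 2 < 2 * k -> #|heavy| < 2 * s.
Proof.
move=> ks s2; rewrite ltnNge; apply/negP => le2s.
have /card_geqP[u [uniq_u size_u uH]] := le2s.
pose H := [set x in u].
have cardH : #|H| = 2 * s by rewrite cardsE -size_u; apply/card_uniqP.
have := sum_card_star H pair_le; rewrite cardH => le_sum.
have : 2 * #|F| <= \sum_(h in H) #|star F [set h]|.
  have s0 : 0 < s by nia.
  rewrite -(leq_pmul2l s0) big_distrr /= mulnA [s * 2]mulnC -cardH -sum_nat_const.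
  apply: leq_sum => h; rewrite inE => /uH; rewrite inE => heavyh.
  by rewrite -leq_sqr expnMn; apply: leq_trans heavyh _; rewrite leq_mul2r ks orbT.
have := pair_degrees_small s2; have : 2 * s * (2 * s * d) = 4 * s ^ 2 * d by ring.
lia.
Qed.

(** Among members whose only heavy point is [h], the sum in [heavy_weight] is one degree. This lifts
    the threshold from order [k^(-1/2)] to order [1/t]. *)
Lemma heavy_star_large h : h \in heavy ->
  8 * t * #|F| < 3 * #|F| + 8 * t ^ 2 * #|star F [set h]|.
Proof.
move=> hH; have [s ks s2] := square_between k9.
have cardH := card_heavy_lt ks s2; have small := pair_degrees_small s2.
have le_only : #|star F [set h]| <= #|star_only F heavy h| + #|heavy| * d.
  by apply: card_star_only => // h'; apply: pair_le.
have leF : #|F| <= s * #|star F [set h]|.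
  move: hH; rewrite inE => heavyh.
  by rewrite -leq_sqr expnMn; apply: leq_trans heavyh _; rewrite leq_mul2r ks orbT.
have [||A] := @heavy_weight (star_only F heavy h).
- by apply/subsetP => A; rewrite inE => /andP[].
- have le1 : #|F| <= 2 * s * #|star_only F heavy h|.
    have : s * #|star F [set h]| <= s * #|star_only F heavy h| + s * (2 * s * d).
      rewrite -mulnDr leq_mul2l; apply/orP; right; apply: leq_trans le_only _.
      by rewrite leq_add2l leq_mul2r ltnW ?orbT.
    have -> : s * (2 * s * d) = 2 * s ^ 2 * d by ring.
    lia.
  (* [2 * s <= k] because [4 * s ^ 2 < 8 * k < k ^ 2]. *)
  by apply: leq_trans le1 _; rewrite leq_mul2r; apply/orP; right; nia.
by rewrite inE => /andP[_ /eqP ->]; rewrite big_set1.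
Qed.

(** With [t + 1] heavy points, [(t + 1) * (8 * t - 3)] would be at most [8 * t ^ 2 + 1], the last 1
    paying for the overlaps; this is false for [t >= 2]. *)
Lemma card_heavy_le : #|heavy| <= t.
Proof.
rewrite leqNgt; apply/negP => /card_geqP[u [uniq_u size_u uH]].
pose H := [set x in u].
have cardH : #|H| = t.+1 by rewrite cardsE -size_u; apply/card_uniqP.
have := sum_card_star H pair_le; rewrite cardH => le_sum.
have : t.+1 * (8 * t * #|F|) <= t.+1 * (3 * #|F|) + 8 * t ^ 2 * \sum_(h in H) #|star F [set h]|.
  rewrite -cardH -!sum_nat_const big_distrr /= -big_split /=.
  by apply: leq_sum => h; rewrite inE => /uH /heavy_star_large /ltnW.
have le2 : 8 * t ^ 2 * (t.+1 * (t.+1 * d)) <= #|F|.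
  apply: leq_trans F_large.
  have -> : 8 * t ^ 2 * (t.+1 * (t.+1 * d)) = 2 * t ^ 2 * (4 * t.+1 ^ 2) * d by ring.
  by rewrite leq_mul2r leq_mul2l kt2 !orbT.
move: le_sum le2; set S := \sum_(h in H) _; set e := t.+1 * (t.+1 * d) => le_sum le2 le3.
have le4 : 8 * t ^ 2 * S <= 8 * t ^ 2 * #|F| + #|F|.
  by apply: leq_trans (leq_mul (leqnn _) le_sum) _; rewrite mulnDr leq_add2l.
have : t.+1 * (8 * t * #|F|) <= t.+1 * (3 * #|F|) + (8 * t ^ 2 * #|F| + #|F|).
  by apply: leq_trans le3 _; rewrite leq_add2l.
have -> : t.+1 * (8 * t * #|F|) = 8 * t ^ 2 * #|F| + 8 * t * #|F| by ring.
nia.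
Qed.

Lemma heavy_cover A : A \in F -> A :&: heavy != set0.
Proof.
move=> AF; apply/negP => /eqP AH; pose G := [set B in F | B :&: heavy == set0].
have smallG : k * #|G| < #|F|.
  rewrite ltnNge; apply/negP => FG.
  have [|B] := heavy_weight _ FG; first by apply/subsetP => B; rewrite inE => /andP[].
  by rewrite inE => /andP[_ /eqP ->]; rewrite big_set0; nia.
(* A member meeting [A] either avoids all heavy points or contains a heavy [h] and a point of [A],
   which differ as [A] has no heavy point. *)
have cover : #|meeting F A| <= #|G| + \sum_(h in heavy) #|meeting (star F [set h]) A|.
  have sub : meeting F A \subset G :|: \bigcup_(h in heavy) meeting (star F [set h]) A.
    apply/subsetP => B; rewrite !inE => /andP[BF BA]; rewrite BF /=.
    case: (eqVneq (B :&: heavy) set0) => //= /set0Pn[h]; rewrite inE => /andP[hB hH].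
    by apply/bigcupP; exists h => //; rewrite !inE BF sub1set hB.
  apply: leq_trans (subset_leq_card sub) _; rewrite cardsU.
  apply: leq_trans (leq_subr _ _) _; rewrite leq_add2l.
  elim/big_rec2: _ => [|x m U _ le_m]; first by rewrite cards0.
  by rewrite cardsU; lia.
have le_sum : \sum_(h in heavy) #|meeting (star F [set h]) A| <= t * (k * d).
  apply: leq_trans (_ : \sum_(h in heavy) k * d <= _); last first.
    by rewrite sum_nat_const leq_mul2r card_heavy_le orbT.
  apply: leq_sum => h hH; apply: leq_trans (card_meeting_le _ _) _.
  rewrite -(F_unif AF) -sum_nat_const; apply: leq_sum => x xA.
  rewrite star_star; apply: pair_le; apply: contraTneq xA => <-.
  by apply/negP => hA; move/setP/(_ h): AH; rewrite in_setI in_set0 hA hH.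
have := F_meeting AF.
have le1 : k * (t * #|meeting F A|) <= t * #|F| + k * (t * (t * (k * d))).
  apply: leq_trans (_ : k * (t * (#|G| + t * (k * d))) <= _).
    rewrite !leq_mul2l; apply/orP; right; apply/orP; right.
    by apply: leq_trans cover _; rewrite leq_add2l.
  rewrite !mulnDr leq_add2r mulnCA leq_mul2l; apply/orP; right; exact: ltnW.
have le2 : 2 * (k * (t * (t * (k * d)))) <= k * #|F|.
  rewrite mulnCA leq_mul2l; apply/orP; right; apply: leq_trans F_large.
  by apply: eq_leq; ring.
nia.
Qed.

End Heavy.

(** * Transfer to the stated definitions and conclusion *)

Lemma card_link n (F : {set {set 'I_n}}) (x : 'I_n) : #|link F x| = #|star F [set x]|.
Proof.
have -> : link F x = [set A :\ x | A in star F [set x]].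
  by apply/setP => B; apply/imsetP/imsetP => -[A AF ->]; exists A => //;
    move: AF; rewrite !inE sub1set.
apply: card_in_imset => A B; rewrite !inE !sub1set => /andP[_ xA] /andP[_ xB] eqAB.
by rewrite -(setD1K xA) eqAB setD1K.
Qed.

Lemma covering_number_le n (F : {set {set 'I_n}}) (S : {set 'I_n}) :
  avoiding F S = set0 -> (covering_number F <= #|S|)%N.
Proof.
move=> FS; rewrite /covering_number.
(* An empty member would avoid [S], so there is none and the default of the arg min is a genuine
   cover. *)
have FT : avoiding F [set: 'I_n] == set0.
  apply/eqP/setP => A; rewrite !inE setIT; apply/negP => /andP[AF /eqP A0].
  by move/setP/(_ set0): FS; rewrite !inE set0I eqxx -A0 AF.
by case: arg_minnP => // X _ minX; apply: minX; rewrite FS.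
Qed.

Lemma card_meeting_max_disjoint_degree n (F : {set {set 'I_n}}) A :
  A \in F -> #|F| <= max_disjoint_degree F + #|meeting F A|.
Proof.
move=> AF; rewrite -(cardsID [set B | B :&: A == set0] F) leq_add //.
  rewrite /max_disjoint_degree (bigD1 A) //= leq_max; apply/orP; left.
  by apply: subset_leq_card; apply/subsetP => B; rewrite !inE.
by apply: subset_leq_card; apply/subsetP => B; rewrite !inE andbC.
Qed.

Local Open Scope ring_scope.

Theorem theorem4 (R : rcfType) (t : nat) (ht : (2 <= t)%N) :
  exists k0 : nat, forall (k n : nat) (F : {set {set 'I_n}}),
    (k0 <= k)%N ->
    (16 * t ^ 2 * k ^ 2 <= n)%N ->
    F \subset ksubsets n k ->
    (2 * t ^ 2 * k * 'C(n - 2, k - 2) <= #|F|)%N ->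
    ((1 - 1 / t%:R) * #|F|%:R <= (max_disjoint_degree F)%:R :> R
     \/ exists S : {set 'I_n},
          [/\ (#|S| <= t)%N,
              avoiding F S = set0
            & forall x : 'I_n, x \in S ->
                (Num.sqrt k%:R)^-1 * #|F|%:R <= #|link F x|%:R :> R])
    /\ ((max_disjoint_degree F)%:R < (1 - 1 / t%:R) * #|F|%:R :> R ->
        (covering_number F <= t)%N).
Proof.
have [k1 klog] := pow4_le_square_log t.
(* [k1] keeps [X] small, 9 serves the comparison of [s] with [k], and [4 * t.+1 ^ 2] absorbs the
   overlaps of [t + 1] stars. *)
exists (maxn k1 (maxn 9 (4 * t.+1 ^ 2))) => k n F.
rewrite !geq_max => /andP[/klog {}klog /andP[k9 kt2]] n_large Fsub F_large.
have F_unif A : A \in F -> #|A| = k.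
  by move/(subsetP Fsub); rewrite inE => /eqP.
suff main : (max_disjoint_degree F)%:R < (1 - 1 / t%:R) * #|F|%:R :> R ->
    [/\ (#|heavy k F| <= t)%N, avoiding F (heavy k F) = set0
      & forall x : 'I_n, x \in heavy k F ->
          (Num.sqrt k%:R)^-1 * #|F|%:R <= #|link F x|%:R :> R].
  split; last by move/main => [le_t /covering_number_le + _]; move/leq_trans; apply.
  by case: lerP => [|/main ?]; [left | right; exists (heavy k F)].
move=> small_degree.
have t0 : 0 < t%:R :> R by rewrite ltr0n; lia.
have F_meeting A : A \in F -> (#|F| < t * #|meeting F A|)%N.
  move/card_meeting_max_disjoint_degree; rewrite -(ler_nat R) natrD => leF.
  rewrite -(ltr_nat R) natrM mulrC -ltr_pdivrMr //.
  move: small_degree; rewrite mulrBl !mul1r mulrC; lra.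
have T_large : (16 * t ^ 2 * k ^ 2 <= #|'I_n|)%N by rewrite card_ord.
have F_large' : (2 * t ^ 2 * k * 'C(#|'I_n| - 2, k - 2) <= #|F|)%N by rewrite card_ord.
split.
- exact: card_heavy_le.
- apply/setP => A; rewrite in_set0 inE; apply/negP => /andP[AF].
  by apply/negP; apply: heavy_cover F_meeting _ AF.
- move=> x; rewrite inE card_link => heavyx.
  have k0 : 0 < k%:R :> R by rewrite ltr0n; lia.
  (* Clearing the root and squaring recovers the natural-number definition of [heavy]. *)
  rewrite ler_pdivrMl ?sqrtr_gt0 // -ler_sqr ?nnegrE ?mulr_ge0 ?sqrtr_ge0 ?ler0n //.
  by rewrite exprMn sqr_sqrtr ?ler0n // -!natrX -natrM ler_nat.
Qed.
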